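(* The period doubling renormalization operator $R$ acting on the space of $C^{1+Lip}$ unimodal maps with quadratic tip, $R:\mathcal U_0^{1+Lip}\to\mathcal U^{1+Lip}$, has infinite topological entropy.
   Context: A unimodal map $f:[0,1]\to[0,1]$ is a $C^1$ map with $f(1)=0$, with a unique point $c\in(0,1)$ (the critical point) where $Df(c)=0$, and with $f(c)=1$. It is $C^{1+Lip}$ if $Df$ is Lipschitz. The critical point $c$ is a quadratic tip if there exist a sequence $x_n\to c$ (with $x_n\neq c$) and a constant $A>0$ such that $\lim_{n\to\infty}\frac{f(x_n)-f(c)}{(x_n-c)^2}=-A$. $\mathcal U^{1+Lip}$ is the set of $C^{1+Lip}$ unimodal maps with a quadratic tip. A unimodal map $f$ with quadratic tip $c$ is renormalizable if (1) $c\in[f^2(c),f^4(c)]=:I_0^1$, (2) $f(I_0^1)=[f^3(c),f(c)]=:I_1^1$, (3) $I_0^1\cap I_1^1=\emptyset$. The set of renormalizable maps in $\mathcal U^{1+Lip}$ is $\mathcal U_0^{1+Lip}$. The renormalization operator is $Rf=h^{-1}\circ f^2\circ h$, where $h:[0,1]\to I_0^1$ is the orientation reversing affine homeomorphism. The topological entropy of a system on a noncompact space is defined as the supremum of the topological entropies of its restrictions to compact invariant subsets (compact sets $K\subset\mathcal U_0^{1+Lip}$ with $R(K)\subset K$ on which $R$ is continuous). The space $\mathcal U^{1+Lip}$ is equipped with the $C^1$ distance $\mathrm{dist}_1$. *)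

(* Defs.v *)
From HB Require Import structures.
From mathcomp Require Import all_boot all_order all_algebra.
From mathcomp Require Import finmap.
From mathcomp Require Import all_classical all_reals all_analysis.

Set Implicit Arguments.
Unset Strict Implicit.
Unset Printing Implicit Defensive.

Import Order.TTheory GRing.Theory Num.Theory.
Import numFieldNormedType.Exports.

Local Open Scope classical_set_scope.
Local Open Scope ring_scope.

(* Functions on the real line of which only the restriction to [0, 1] matters.
   This is a separate name for [R -> R] because it carries the C^1 topology
   below instead of the pointwise topology that MathComp-Analysis puts on
   function types. *)
Definition imap (R : realType) : Type := R -> R.

HB.instance Definition _ (R : realType) := Choice.copy (imap R) (R -> R).

(* Difference quotient at [x] and derivative relative to [0, 1]: one-sided at
   the two endpoints. *)
Definition dquot (R : realType) (f : imap R) (x : R) : R -> R :=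
  fun y => (f y - f x) / (y - x).

Definition dnbhs01 (R : realType) (x : R) : set_system R :=
  within `[0, 1] x^'.

Definition D01 (R : realType) (f : imap R) (x : R) : R :=
  lim (dquot f x @ dnbhs01 x).

Definition C1_01 (R : realType) (f : imap R) : Prop :=
  (forall x, x \in `[0, 1] -> cvg (dquot f x @ dnbhs01 x)) /\
  {within `[0, 1], continuous (D01 f)}.

(* The C^1 distance  sup |f - g| + sup |Df - Dg|  (suprema over [0, 1]).  It is
   finite on C^1 maps; on arbitrary functions it takes values in [0, +oo]. *)
Definition dist1 (R : realType) (f g : imap R) : \bar R :=
  (ereal_sup [set `|f x - g x|%:E | x in `[0%R, 1%R]] +
   ereal_sup [set `|D01 f x - D01 g x|%:E | x in `[0%R, 1%R]])%E.

Section C1_pseudometric.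
Variable R : realType.
Implicit Types (f g k : imap R) (u v w : R -> R).

Local Notation supd u v :=
  (ereal_sup [set `|u x - v x|%:E | x in `[0%R, 1%R]]).

Let in01 : `[0, 1]%classic (0 : R).
Proof. by rewrite /= in_itv /= lexx ler01. Qed.

Let supd_ge0 u v : (0 <= supd u v)%E.
Proof.
apply: (@le_trans _ _ (`|u 0 - v 0|%:E)); first by rewrite lee_fin.
by apply: ereal_sup_ubound; exists 0.
Qed.

Let supdxx u : supd u u = 0%E.
Proof.
apply/eqP; rewrite eq_le supd_ge0 andbT.
by apply: ge_ereal_sup => _ [x _ <-]; rewrite subrr normr0.
Qed.

Let supdC u v : supd u v = supd v u.
Proof. by congr ereal_sup; apply: eq_imagel => x _; rewrite distrC. Qed.

Let supd_triangle v u w : (supd u w <= supd u v + supd v w)%E.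
Proof.
apply: ge_ereal_sup => _ [x x01 <-].
apply: (@le_trans _ _ (`|u x - v x|%:E + `|v x - w x|%:E)%E).
  by rewrite -EFinD lee_fin ler_distD.
by apply: leeD; apply: ereal_sup_ubound; exists x.
Qed.

Let ball1 f (e : R) : set (imap R) := [set g | (dist1 f g < e%:E)%E].

Let ball1_center f (e : R) : 0 < e -> ball1 f e f.
Proof. by move=> e0; rewrite /ball1 /= /dist1 !supdxx adde0 lte_fin. Qed.

Let ball1_sym f g (e : R) : ball1 f e g -> ball1 g e f.
Proof. by rewrite /ball1 /= /dist1 (supdC f) (supdC (D01 f)). Qed.

Let ball1_triangle f g k (e1 e2 : R) :
  ball1 f e1 g -> ball1 g e2 k -> ball1 f (e1 + e2) k.
Proof.
rewrite /ball1 /= EFinD => fg gk; apply: le_lt_trans (lteD fg gk).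
rewrite /dist1 addeACA; apply: leeD; exact: supd_triangle.
Qed.

HB.instance Definition _ := hasNbhs.Build (imap R) (nbhs_ (entourage_ ball1)).

HB.instance Definition _ := Nbhs_isPseudoMetric.Build R (imap R)
  erefl ball1_center ball1_sym ball1_triangle erefl.

End C1_pseudometric.

Lemma imap_ballE (R : realType) (f g : imap R) (e : R) :
  ball f e g = (dist1 f g < e%:E)%E.
Proof. by []. Qed.

Definition critical (R : realType) (f : imap R) (c : R) : Prop :=
  0 < c < 1 /\ D01 f c = 0.

Definition crit (R : realType) (f : imap R) : R := xget 0 (critical f).

(* A map of [0, 1] is represented by its extension by 0 to the real line, so
   that equality of representatives is equality of maps. *)
Definition unimodal (R : realType) (f : imap R) : Prop :=
  [/\ forall x, x \notin `[0, 1] -> f x = 0,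
      forall x, x \in `[0, 1] -> f x \in `[0, 1],
      C1_01 f,
      f 1 = 0 &
      (exists! c, critical f c) /\ f (crit f) = 1].

Definition C1Lip (R : realType) (f : imap R) : Prop :=
  C1_01 f /\
  exists L : R, forall x y, x \in `[0, 1] -> y \in `[0, 1] ->
    `|D01 f x - D01 f y| <= L * `|x - y|.

Definition quadratic_tip (R : realType) (f : imap R) (c : R) : Prop :=
  exists (x : nat -> R) (A : R),
    [/\ 0 < A,
        forall n, x n \in `[0, 1] /\ x n != c,
        x n @[n --> \oo] --> c &
        (f (x n) - f c) / (x n - c) ^+ 2 @[n --> \oo] --> - A].

Definition U1Lip (R : realType) : set (imap R) :=
  [set f | [/\ unimodal f, C1Lip f & quadratic_tip f (crit f)]].

Definition I01 (R : realType) (f : imap R) : set R :=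
  `[iter 2 f (crit f), iter 4 f (crit f)].

Definition I11 (R : realType) (f : imap R) : set R :=
  `[iter 3 f (crit f), f (crit f)].

Definition renormalizable (R : realType) (f : imap R) : Prop :=
  [/\ I01 f (crit f), f @` I01 f = I11 f & I01 f `&` I11 f = set0].

Definition U0_1Lip (R : realType) : set (imap R) :=
  [set f | U1Lip f /\ renormalizable f].

(* The affine map sending 0 to f^4(c) and 1 to f^2(c), and its inverse; it
   reverses orientation because f^2(c) < f^4(c) when [f] is renormalizable. *)
Definition rescale (R : realType) (f : imap R) (x : R) : R :=
  iter 4 f (crit f) + (iter 2 f (crit f) - iter 4 f (crit f)) * x.

Definition rescale_inv (R : realType) (f : imap R) (y : R) : R :=
  (y - iter 4 f (crit f)) / (iter 2 f (crit f) - iter 4 f (crit f)).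

(* The formula makes sense for every [f]; only its values on [U0_1Lip] are
   used. *)
Definition renorm (R : realType) (f : imap R) : imap R :=
  fun x => if x \in `[0, 1] then rescale_inv f (f (f (rescale f x))) else 0.

Section Entropy.
Context {R : realType} {X : pseudoMetricType R}.
Implicit Types (T : X -> X) (K : set X) (e : R) (n : nat).

Definition separated T K n e (S : {fset X}) : Prop :=
  [set` S] `<=` K /\
  forall x y, x \in S -> y \in S -> x != y ->
    exists2 i, (i < n)%N & ~ ball (iter i T x) e (iter i T y).

Definition max_separated T K n e : \bar R :=
  ereal_sup [set (#|` S|%:R)%:E | S in [set S | separated T K n e S]].

Definition entropy_at T K e : \bar R :=
  limn_esup (fun n => (lne (max_separated T K n e) * (n%:R^-1)%:E)%E).

(* Bowen's entropy of [T] on the compact invariant set [K]; [entropy_at] grows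
   as [e] decreases, so the limit as [e] tends to 0 is the supremum. *)
Definition entropy_compact T K : \bar R :=
  ereal_sup [set entropy_at T K e | e in [set e | 0 < e]].

(* Entropy of a map [T] with domain [D], where [D] need not be compact. *)
Definition entropy (D : set X) T : \bar R :=
  ereal_sup [set entropy_compact T K | K in
    [set K | [/\ compact K, K `<=` D, T @` K `<=` K &
                 {within K, continuous T}]]].

End Entropy.

(* Main.v *)
Require Import Defs.
From mathcomp Require Import all_boot all_order all_algebra.
From mathcomp Require Import finmap ring lra.
From mathcomp Require Import all_classical all_reals all_analysis.

Set Implicit Arguments.
Unset Strict Implicit.
Unset Printing Implicit Defensive.

Import Order.TTheory GRing.Theory Num.Theory.
Import numFieldNormedType.Exports.

Local Open Scope classical_set_scope.
Local Open Scope ring_scope.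

(* Fix [s > 0] with [2 s^2 + 2 s = 1] and let [z = (1 + s) x - s], so that
   [z] runs over [- s, 1] and vanishes at the critical point [c = s / (1 + s)].
   A map [f = 1 - g] that is affine on [1 - s^2, 1] with [f (1 - s^2) = s] satisfies
   [1 - R f = g (s (1 - x)) / s^2], and [x |-> s (1 - x)] is [z |-> - s z].  The
   map [f_w = 1 - g_w] with
     [g_w = z^2 + \sum_n s^(2 n) bump_(w n) (z / (- s)^n)]
   therefore has [R f_w = f_(w shifted)], as long as each C^(1+Lip) bump [bump_t],
   supported in [1/5, 1], makes [z^2 + bump_t] affine near 1.  The bumps at
   different levels have disjoint supports, and the rescaling preserves their
   second order Taylor constants, so that [f_w] is C^(1+Lip); at the points
   [z = (- s)^n] it is exactly quadratic.  The gap between [s] and [1 - s^2] leaves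
   a one-parameter freedom in [bump_t], so [w] ranges over [0, 1]^nat: on a
   compact set, R is conjugate to a shift with a continuum of symbols, which has
   infinite entropy. *)

(** * Uniform first-order Taylor bounds *)

Section Taylor.
Variable R : realType.
Implicit Types (u v du dv : R -> R) (a b k C x y : R).

(** Packs differentiability with a Lipschitz derivative into one inequality, stable under sums,
    multiples and affine substitutions with explicit constants. *)
Definition taylor1 C u du : Prop :=
  forall x y, `|u y - u x - du x * (y - x)| <= C * (y - x) ^+ 2.

Lemma taylor1D C1 C2 u v du dv : taylor1 C1 u du -> taylor1 C2 v dv ->
  taylor1 (C1 + C2) (fun x => u x + v x) (fun x => du x + dv x).
Proof.
move=> hu hv x y; rewrite /= [(C1 + C2) * _]mulrDl.
have -> : u y + v y - (u x + v x) - (du x + dv x) * (y - x) =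
  (u y - u x - du x * (y - x)) + (v y - v x - dv x * (y - x)) by ring.
exact: le_trans (ler_normD _ _) (lerD (hu x y) (hv x y)).
Qed.

Lemma taylor1Z C k u du : taylor1 C u du ->
  taylor1 (`|k| * C) (fun x => k * u x) (fun x => k * du x).
Proof.
move=> hu x y /=.
have -> : k * u y - k * u x - k * du x * (y - x) =
  k * (u y - u x - du x * (y - x)) by ring.
by rewrite normrM -mulrA ler_wpM2l.
Qed.

Lemma taylor1W C1 C2 u du : C1 <= C2 -> taylor1 C1 u du -> taylor1 C2 u du.
Proof.
move=> le12 hu x y; apply: le_trans (hu x y) _.
by rewrite ler_wpM2r ?sqr_ge0.
Qed.

Lemma taylor1_affine C a b u du : taylor1 C u du ->
  taylor1 (C * a ^+ 2) (fun x => u (a * x + b)) (fun x => a * du (a * x + b)).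
Proof.
move=> hu x y /=; have := hu (a * x + b) (a * y + b).
have -> : a * y + b - (a * x + b) = a * (y - x) by ring.
by rewrite [du _ * (a * _)]mulrCA exprMn !mulrA.
Qed.

(** Adding the bounds based at [x] and at [y] cancels the values of [u] and leaves the difference of
    the derivatives. *)
Lemma taylor1_lipschitz C u du x y : taylor1 C u du ->
  `|du x - du y| <= 2 * C * `|x - y|.
Proof.
move=> hu; have [->|nxy] := eqVneq x y; first by rewrite !subrr normr0 mulr0.
have d0 : 0 < `|x - y| by rewrite normr_gt0 subr_eq0.
rewrite -(ler_pM2r d0) -normrM.
have -> : (du x - du y) * (x - y) = (u y - u x - du x * (y - x)) +
  (u x - u y - du y * (x - y)) by ring.
apply: le_trans (ler_normD _ _) _; apply: le_trans (lerD (hu x y) (hu y x)) _.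
rewrite -[2 * C * _ * _]mulrA -expr2 real_normK ?num_real//.
by rewrite le_eqVlt; apply/orP; left; apply/eqP; ring.
Qed.

Lemma taylor1_continuous C u du : taylor1 C u du -> continuous u.
Proof.
move=> hu x; apply/cvgrPdist_le => e e0.
set M := `|C| + `|du x| + 1.
have M0 : 0 < M by rewrite /M; have := normr_ge0 C; have := normr_ge0 (du x); lra.
have m0 : 0 < Num.min 1 (e / M) by rewrite lt_min ltr01 divr_gt0.
near=> y.
have : `|y - x| < Num.min 1 (e / M).
  by rewrite distrC; near: y; apply: (@nbhsx_ballx _ R x _ m0).
rewrite lt_min => /andP[d1 d2].
have -> : u x - u y = - ((u y - u x - du x * (y - x)) + du x * (y - x)) by ring.
rewrite normrN; apply: le_trans (ler_normD _ _) _.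
apply: le_trans (lerD (hu x y) (lexx _)) _.
rewrite normrM -[(y - x) ^+ 2]real_normK ?num_real//.
move: d2; rewrite ltr_pdivlMr// /M => d2.
have := normr_ge0 (y - x); have := ler_norm C; have := normr_ge0 C.
have := normr_ge0 (du x); move: d1 d2.
move: `|y - x| `|C| `|du x| => d c D d1 d2 D0 c0 cC dd0.
have h1 : C * d ^+ 2 <= c * d ^+ 2 by rewrite ler_wpM2r// sqr_ge0.
have h2 : c * d ^+ 2 <= c * d by rewrite ler_wpM2l// expr2 ler_piMl// ltW.
nra.
Unshelve. all: by end_near. Qed.

Lemma taylor1_sq : taylor1 1 (fun x => x ^+ 2) (fun x => 2 * x).
Proof.
move=> x y /=; have -> : y ^+ 2 - x ^+ 2 - 2 * x * (y - x) = (y - x) ^+ 2 by ring.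
by rewrite ger0_norm ?sqr_ge0// mul1r.
Qed.

(** Its square is the basic C^(1+Lip) function with one jump of the second derivative; the bumps are
    combinations of such squares. *)
Definition pospart a x : R := Num.max (x - a) 0.

Lemma pospart_le a x : x <= a -> pospart a x = 0.
Proof. by move=> xa; rewrite /pospart max_r// subr_le0. Qed.

Lemma pospart_ge a x : a <= x -> pospart a x = x - a.
Proof. by move=> ax; rewrite /pospart max_l// subr_ge0. Qed.

Lemma taylor1_pospart a :
  taylor1 1 (fun x => pospart a x ^+ 2) (fun x => 2 * pospart a x).
Proof.
move=> x y /=; rewrite ler_norml.
case: (leP x a) => xa; case: (leP y a) => ya;
  rewrite ?(pospart_le xa) ?(pospart_le ya) ?(pospart_ge (ltW xa)) ?(pospart_ge (ltW ya)).
- by have := sqr_ge0 (y - x) => ?; apply/andP; split; lra.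
- have : 0 <= (y - a) * (a - x) by rewrite mulr_ge0// subr_ge0// ltW.
  have := sqr_ge0 (a - x); have := sqr_ge0 (y - a) => ? ? ?.
  by apply/andP; split; lra.
- have : 0 <= (x - a) * (a - y) by rewrite mulr_ge0// subr_ge0// ltW.
  have := sqr_ge0 (a - y); have := sqr_ge0 (x - a) => ? ? ?.
  by apply/andP; split; lra.
- by have := sqr_ge0 (y - x) => ?; apply/andP; split; lra.
Qed.

End Taylor.

(** * Derivatives relative to [0, 1] and the C^1 distance *)

Section C1.
Variable R : realType.
Implicit Types (f g : imap R) (F dF : R -> R) (x y C : R).

Lemma itv01P x : (x \in `[0, 1]) = (0 <= x <= 1).
Proof. by rewrite in_itv. Qed.

Lemma dnbhs01_filter x : Filter (dnbhs01 x).
Proof. exact: within_filter. Qed.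

Lemma dnbhs01_proper x : 0 <= x <= 1 -> ProperFilter (dnbhs01 x).
Proof.
move=> /andP[x0 x1]; have FF := dnbhs01_filter x; apply: Build_ProperFilter_ex.
move=> P; rewrite /dnbhs01 /within /= => /nbhs_ballP[e /= e0 he].
(* A step of at most 1/2 towards the farther endpoint stays in [0, 1]. *)
pose d := Num.min (e / 2) (1 / 2).
have d0 : 0 < d by rewrite lt_min; apply/andP; split; lra.
have de : d < e by rewrite gt_min; apply/orP; left; lra.
have dh : d <= 1 / 2 by rewrite ge_min lexx orbT.
case: (leP x (1 / 2)) => xh.
- exists (x + d); apply: he; rewrite /= ?itv01P; last by apply/andP; split; lra.
    by rewrite /ball /= opprD addrA subrr sub0r normrN gtr0_norm.
  by rewrite -subr_eq0 addrC addKr gt_eqF.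
- exists (x - d); apply: he; rewrite /= ?itv01P; last by apply/andP; split; lra.
    by rewrite /ball /= opprB addrC subrK gtr0_norm.
  by rewrite -subr_eq0 addrC addKr oppr_eq0 gt_eqF.
Qed.

Section Representative.
Variables (f : imap R) (F dF : R -> R) (C : R).
Hypothesis fF : forall x, 0 <= x <= 1 -> f x = F x.
Hypothesis FdF : taylor1 C F dF.

(** Dividing the Taylor bound by [|y - x|] bounds the error of the difference quotient by
    [C * |y - x|]. *)
Lemma dquot_cvg x : 0 <= x <= 1 -> dquot f x @ dnbhs01 x --> dF x.
Proof.
move=> x01; have FF := dnbhs01_filter x; apply/cvgrPdist_le => e e0.
have M0 : 0 < `|C| + 1 by rewrite ltr_wpDl.
rewrite /dnbhs01 /within /=; apply/nbhs_ballP; exists (e / (`|C| + 1)).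
  by rewrite /= divr_gt0.
rewrite /ball /= => y xy yx; rewrite itv01P => y01.
have d0 : 0 < `|y - x| by rewrite normr_gt0 subr_eq0.
rewrite /dquot (fF x01) (fF y01) -(ler_pM2r d0) -normrM mulrBl divfK ?subr_eq0//.
rewrite distrC; apply: le_trans (FdF x y) _.
rewrite -[(y - x) ^+ 2]real_normK ?num_real// expr2 mulrA ler_pM2r//.
move: xy; rewrite distrC ltr_pdivlMr// => xy; apply: le_trans (ltW xy).
by rewrite mulrC ler_wpM2l//; apply: le_trans (ler_norm _) _; rewrite lerDl.
Qed.

Lemma D01E x : 0 <= x <= 1 -> D01 f x = dF x.
Proof.
move=> x01; have PF := dnbhs01_proper x01.
by apply: cvg_lim; [exact: Rhausdorff | exact: dquot_cvg].
Qed.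

Lemma taylor1_derivative_continuous : continuous dF.
Proof.
move=> x; apply/cvgrPdist_le => e e0.
have M0 : 0 < 2 * `|C| + 1 by rewrite ltr_wpDl// mulr_ge0.
near=> y; apply: le_trans (taylor1_lipschitz x y FdF) _.
have : `|x - y| < e / (2 * `|C| + 1).
  by near: y; apply: (@nbhsx_ballx _ R x); rewrite divr_gt0.
rewrite ltr_pdivlMr// => xy; apply: le_trans (ltW xy).
rewrite mulrC ler_wpM2l//; have := ler_norm C; lra.
Unshelve. all: by end_near. Qed.

Lemma C1Lip_taylor1 : C1Lip f.
Proof.
split; [split|].
- by move=> x; rewrite itv01P => x01; apply: cvgP (dquot_cvg x01).
- apply: (@subspace_eq_continuous _ _ _ dF).
    by move=> x; rewrite inE /= itv01P => x01; apply/esym/D01E.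
  exact/continuous_subspaceT/taylor1_derivative_continuous.
- exists (2 * C) => x y; rewrite !itv01P => x01 y01.
  by rewrite !D01E//; exact: taylor1_lipschitz FdF.
Qed.

End Representative.

Lemma dist1_le f g (a b : R) :
  (forall x, 0 <= x <= 1 -> `|f x - g x| <= a) ->
  (forall x, 0 <= x <= 1 -> `|D01 f x - D01 g x| <= b) ->
  (dist1 f g <= (a + b)%:E)%E.
Proof.
move=> ha hb; rewrite /dist1 EFinD; apply: leeD; apply: ge_ereal_sup => _ [x + <-];
  rewrite /= itv01P lee_fin; [exact: ha | exact: hb].
Qed.

Lemma dist1_lt f g (d : R) x : (dist1 f g < d%:E)%E -> 0 <= x <= 1 ->
  `|f x - g x| < d /\ `|D01 f x - D01 g x| < d.
Proof.
rewrite /dist1 => fgd x01.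
have h1 : (`|f x - g x|%:E <=
    ereal_sup [set `|f x - g x|%:E | x in `[0%R, 1%R]])%E.
  by apply: ereal_sup_ubound; exists x; rewrite //= itv01P.
have h2 : (`|D01 f x - D01 g x|%:E <=
    ereal_sup [set `|D01 f x - D01 g x|%:E | x in `[0%R, 1%R]])%E.
  by apply: ereal_sup_ubound; exists x; rewrite //= itv01P.
have := le_lt_trans (leeD h1 h2) fgd; rewrite -EFinD lte_fin.
by have := normr_ge0 (f x - g x); have := normr_ge0 (D01 f x - D01 g x); split; lra.
Qed.

End C1.

(** * The one-parameter family of piecewise quadratic bumps *)

Section Bump.
Variable R : realType.
Implicit Types (t v : R).

(* The derivative of [bump t] is continuous and affine between the knots 1/5, 2/5,
   3/5, 4/5, 1, where it takes the values 0, 2/5 - t, t - 4/5, 2/5, 0; the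
   coefficients are half its jumps of slope. *)
Definition bump t v : R :=
  (2 - 5 * t) / 2 * pospart (1 / 5) v ^+ 2 + (15 * t - 8) / 2 * pospart (2 / 5) v ^+ 2 +
  (12 - 15 * t) / 2 * pospart (3 / 5) v ^+ 2 + (5 * t - 8) / 2 * pospart (4 / 5) v ^+ 2 +
  1 * pospart 1 v ^+ 2.

Definition dbump t v : R :=
  (2 - 5 * t) / 2 * (2 * pospart (1 / 5) v) + (15 * t - 8) / 2 * (2 * pospart (2 / 5) v) +
  (12 - 15 * t) / 2 * (2 * pospart (3 / 5) v) + (5 * t - 8) / 2 * (2 * pospart (4 / 5) v) +
  1 * (2 * pospart 1 v).

(** The constant is 2 + 4 + 6 + 4 + 1, from bounds on the five coefficients. *)
Lemma taylor1_bump t : 0 <= t <= 1 -> taylor1 17 (bump t) (dbump t).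
Proof.
move=> /andP[t0 t1].
have H := taylor1D (taylor1D (taylor1D (taylor1D
  (taylor1Z ((2 - 5 * t) / 2) (taylor1_pospart (1 / 5)))
  (taylor1Z ((15 * t - 8) / 2) (taylor1_pospart (2 / 5))))
  (taylor1Z ((12 - 15 * t) / 2) (taylor1_pospart (3 / 5))))
  (taylor1Z ((5 * t - 8) / 2) (taylor1_pospart (4 / 5))))
  (taylor1Z 1 (taylor1_pospart 1)).
apply: taylor1W H; rewrite !mulr1 normr1.
have : `|(2 - 5 * t) / 2| <= 2 by rewrite ler_norml; apply/andP; split; lra.
have : `|(15 * t - 8) / 2| <= 4 by rewrite ler_norml; apply/andP; split; lra.
have : `|(12 - 15 * t) / 2| <= 6 by rewrite ler_norml; apply/andP; split; lra.
have : `|(5 * t - 8) / 2| <= 4 by rewrite ler_norml; apply/andP; split; lra.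
lra.
Qed.

(** Beyond 1 all five squares are active and their sum cancels identically. *)
Lemma bump_out t v : ~~ (1 / 5 < v < 1) -> bump t v = 0 /\ dbump t v = 0.
Proof.
rewrite negb_and -!leNgt => /orP[] h; rewrite /bump /dbump.
  by rewrite !pospart_le; [split; ring | lra..].
by rewrite !pospart_ge; [split; field | lra..].
Qed.

Lemma bump_knots t v : 1 / 5 <= v <= 1 ->
  [\/ [/\ v <= 2 / 5, bump t v = (2 - 5 * t) / 2 * (v - 1 / 5) ^+ 2 &
        dbump t v = (2 - 5 * t) * (v - 1 / 5)],
      [/\ 2 / 5 <= v <= 3 / 5,
        bump t v = (5 * t - 3) * (v - 2 / 5) ^+ 2 + (2 - 5 * t) / 5 * (v - 2 / 5) +
                  (2 - 5 * t) / 50 &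
        dbump t v = (10 * t - 6) * (v - 2 / 5) + (2 - 5 * t) / 5],
      [/\ 3 / 5 <= v <= 4 / 5,
        bump t v = (6 - 5 * t) / 2 * (v - 3 / 5) ^+ 2 + (5 * t - 4) / 5 * (v - 3 / 5) +
                  - t / 10 &
        dbump t v = (6 - 5 * t) * (v - 3 / 5) + (5 * t - 4) / 5] |
      [/\ 4 / 5 <= v, bump t v = - (1 - v) ^+ 2 & dbump t v = 2 * (1 - v)]].
Proof.
move=> /andP[v0 v1]; rewrite /bump /dbump (pospart_le v1) (pospart_ge v0).
case: (leP v (2 / 5)) => h2.
  by apply: Or41; rewrite !pospart_le; [split=> //; field | lra..].
rewrite (pospart_ge (ltW h2)); case: (leP v (3 / 5)) => h3.
  apply: Or42; rewrite !pospart_le; [|lra..].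
  by split; [apply/andP; split; lra | field | field].
rewrite (pospart_ge (ltW h3)); case: (leP v (4 / 5)) => h4.
  apply: Or43; rewrite !pospart_le; [|lra..].
  by split; [apply/andP; split; lra | field | field].
by rewrite (pospart_ge (ltW h4)); apply: Or44; split; [exact: ltW | field | field].
Qed.

(** Nonnegative products from which the polynomial inequalities on each piece, with [u] the distance
    to the left knot, follow by linear arithmetic. *)
Lemma unit_products t u : 0 <= t <= 1 -> 0 <= u <= 1 / 5 ->
  [/\ 0 <= t * u, 0 <= t * (1 / 5 - u), 0 <= (1 - t) * u,
     0 <= (1 - t) * (1 / 5 - u) &
     [/\ 0 <= u * u, 0 <= u * (1 / 5 - u), 0 <= t * (u * u),
        0 <= (1 - t) * (u * u) & 0 <= t * (u * (1 / 5 - u)) /\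
        0 <= (1 - t) * (u * (1 / 5 - u))]].
Proof.
move=> /andP[t0 t1] /andP[u0 u1].
have h1 : 0 <= 1 - t by lra.
have h2 : 0 <= 1 / 5 - u by lra.
by do !split; rewrite !mulr_ge0.
Qed.

Lemma bump_range t v : 0 <= t <= 1 -> 1 / 5 <= v <= 1 ->
  0 <= v ^+ 2 + bump t v <= 1.
Proof.
move=> t01 v01.
have h a : 0 <= v - a <= 1 / 5 -> _ := unit_products t01.
case: (bump_knots t v01) => -[].
- move=> v2 -> _.
  have /h[? ? ? ? [? ? ? ? [? ?]]] : 0 <= v - 1 / 5 <= 1 / 5.
    by apply/andP; split; lra.
  by apply/andP; split; lra.
- move=> /andP[v2 v3] -> _.
  have /h[? ? ? ? [? ? ? ? [? ?]]] : 0 <= v - 2 / 5 <= 1 / 5.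
    by apply/andP; split; lra.
  by apply/andP; split; lra.
- move=> /andP[v2 v3] -> _.
  have /h[? ? ? ? [? ? ? ? [? ?]]] : 0 <= v - 3 / 5 <= 1 / 5.
    by apply/andP; split; lra.
  by apply/andP; split; lra.
- move=> v2 -> _.
  have /h[? ? ? ? [? ? ? ? [? ?]]] : 0 <= v - 4 / 5 <= 1 / 5.
    by apply/andP; split; lra.
  by apply/andP; split; lra.
Qed.

(** On the support this slope is affine between knots, where it takes the positive values 2/5, 6/5 -
    t, t + 2/5, 2, 2. *)
Lemma bump_slope t v : 0 <= t <= 1 -> v != 0 -> 2 * v + dbump t v != 0.
Proof.
move=> t01 v0.
have [/andP[v1 v2]|/bump_out-/(_ t)[_ ->]] := boolP (1 / 5 < v < 1); last first.
  by rewrite addr0 mulf_neq0.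
have v01 : 1 / 5 <= v <= 1 by rewrite !ltW.
have h a : 0 <= v - a <= 1 / 5 -> _ := unit_products t01.
rewrite gt_eqF//; case: (bump_knots t v01) => -[].
- move=> v3 _ ->; have /h[? ? ? ? _] : 0 <= v - 1 / 5 <= 1 / 5.
    by apply/andP; split; lra.
  lra.
- move=> /andP[v3 v4] _ ->; have /h[? ? ? ? _] : 0 <= v - 2 / 5 <= 1 / 5.
    by apply/andP; split; lra.
  by move/andP: t01 => [? ?]; lra.
- move=> /andP[v3 v4] _ ->; have /h[? ? ? ? _] : 0 <= v - 3 / 5 <= 1 / 5.
    by apply/andP; split; lra.
  by move/andP: t01 => [? ?]; lra.
- by move=> v3 _ ->; lra.
Qed.

(** Adding [v^2] gives [2 v - 1]: this piece makes the map affine near 1. *)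
Lemma bump_last t v : 4 / 5 <= v <= 1 -> bump t v = - (1 - v) ^+ 2.
Proof.
by move=> /andP[v0 v1]; rewrite /bump (pospart_le v1) !pospart_ge; [field | lra..].
Qed.

(** At this point the parameter can be read off from the value. *)
Lemma bump_two_fifths t : bump t (2 / 5) = (2 - 5 * t) / 50.
Proof. by rewrite /bump pospart_ge ?pospart_le; [field | lra..]. Qed.

Lemma bump_sub t t' v : `|bump t v - bump t' v| <= `|t - t'| /\
  `|dbump t v - dbump t' v| <= `|t - t'|.
Proof.
have [/andP[v1 v2]|o] := boolP (1 / 5 < v < 1); last first.
  by have [-> ->] := bump_out t o; have [-> ->] := bump_out t' o; rewrite subrr normr0.
have v01 : 1 / 5 <= v <= 1 by rewrite !ltW.
suff [b [db [-> -> ? ?]]] : exists b db, [/\ bump t v - bump t' v = (t - t') * b,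
    dbump t v - dbump t' v = (t - t') * db, `|b| <= 1 & `|db| <= 1].
  by rewrite !normrM !ler_piMr.
(* Both functions are affine in [t]; the witnesses are the coefficients of [t]. *)
exists (- 5 / 2 * pospart (1 / 5) v ^+ 2 + 15 / 2 * pospart (2 / 5) v ^+ 2 -
  15 / 2 * pospart (3 / 5) v ^+ 2 + 5 / 2 * pospart (4 / 5) v ^+ 2).
exists (- 5 * pospart (1 / 5) v + 15 * pospart (2 / 5) v -
  15 * pospart (3 / 5) v + 5 * pospart (4 / 5) v).
split; [by rewrite /bump; field | by rewrite /dbump; field | |];
  rewrite (pospart_ge (ltW v1)) ler_norml; case: (leP v (2 / 5)) => h2;
  rewrite ?(pospart_le h2) ?(pospart_ge (ltW h2)); case: (leP v (3 / 5)) => h3;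
  rewrite ?(pospart_le h3) ?(pospart_ge (ltW h3)); case: (leP v (4 / 5)) => h4;
  rewrite ?(pospart_le h4) ?(pospart_ge (ltW h4)); apply/andP; split; nra.
Qed.

End Bump.

(** * Superposition of rescaled bumps and its self-similarity *)

Section Tower.
Variable R : realType.
Implicit Types (w : nat -> R) (t v z : R) (n m : nat).

(* The positive root of [2 s^2 + 2 s = 1], the value for which the slopes at 1 of
   the quadratic [zoom x ^ 2] and of the affine branch [1 - (1 - x) / s] agree. *)
Definition ratio : R := (Num.sqrt 3 - 1) / 2.

Local Notation s := ratio.

Lemma ratio_sq : s ^+ 2 = 1 / 2 - s.
Proof.
rewrite /ratio; have : Num.sqrt 3 ^+ 2 = 3 :> R by rewrite sqr_sqrtr.
by move: (Num.sqrt 3) => r r3; lra.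
Qed.

Lemma ratio_bounds : 36 / 100 < s < 37 / 100.
Proof.
have r0 : 0 <= Num.sqrt 3 :> R by exact: sqrtr_ge0.
have r2 : Num.sqrt 3 ^+ 2 = 3 :> R by rewrite sqr_sqrtr.
by rewrite /ratio; move: r0 r2; move: (Num.sqrt 3) => r r0 r3; apply/andP; split; nra.
Qed.

Lemma ratio_gt0 : 0 < s.
Proof. by have /andP[] := ratio_bounds; lra. Qed.

Definition scale n : R := (- s) ^+ n.

Lemma scale_neq0 n : scale n != 0.
Proof. by rewrite expf_neq0// oppr_eq0 gt_eqF// ratio_gt0. Qed.

Lemma scaleS n : scale n.+1 = - s * scale n.
Proof. exact: exprS. Qed.

Lemma scale_norm n : `|scale n| = s ^+ n.
Proof. by rewrite normrX normrN gtr0_norm// ratio_gt0. Qed.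

Definition hit n z : bool := 1 / 5 < (scale n)^-1 * z < 1.

(** One division by [- s] makes [v] negative; two multiply it by [s^-2 > 5], so that it exceeds 1,
    hence also 1/5, and the induction goes on by two levels. *)
Lemma scale_escape n v : 1 / 5 <= v ->
  (scale n.+1)^-1 * v < 0 \/ 1 < (scale n.+1)^-1 * v.
Proof.
have /andP[sl su] := ratio_bounds; have s2 := ratio_sq.
move=> v0; suff h k u : 1 / 5 <= u -> (scale k.+1)^-1 * u < 0 \/
    1 < (scale k.+1)^-1 * u by exact: h.
have step x : - (s^-1) * (- (s^-1) * x) = x / (s ^+ 2).
  by rewrite mulrA mulrNN -invfM -expr2 mulrC.
have eS j x : (scale j.+1)^-1 * x = (scale j)^-1 * (- (s^-1) * x).
  by rewrite scaleS invfM invrN -!mulrA mulrCA.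
have si : 0 < s^-1 by rewrite invr_gt0 ratio_gt0.
have step5 x : 1 / 5 <= x -> 1 < - (s^-1) * (- (s^-1) * x).
  by move=> x5; rewrite step ltr_pdivlMr ?exprn_gt0 ?ratio_gt0// mul1r s2; lra.
elim/ltn_ind: k u => -[_ u u5|[_ u u5|k IH u u5]].
- by left; rewrite eS /scale expr0 invr1 mul1r mulNr oppr_lt0 mulr_gt0//; lra.
- by right; rewrite 2!eS /scale expr0 invr1 mul1r step5.
- by rewrite 2!eS; apply: IH => //; have := step5 _ u5; lra.
Qed.

Lemma hit_uniq n m z : hit n z -> hit m z -> n = m.
Proof.
have key i j : (i < j)%N -> hit i z -> hit j z -> False.
  move=> ij /andP[h1 _] /andP[h3 h4].
  have e : (scale j)^-1 * z = (scale (j - i.+1).+1)^-1 * ((scale i)^-1 * z).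
    by rewrite mulrA -invfM /scale -exprD addSn -addnS subnK.
  by move: h3 h4; rewrite e; case: (scale_escape (j - i.+1) (ltW h1)); lra.
by move=> hn hm; case: (ltngtP n m) => // lt; case: (key _ _ lt).
Qed.

(** If no bump is hit, the default is level 0, whose term then vanishes. *)
Definition idx z : nat := xget 0%N [set n | hit n z].

Lemma idxE n z : hit n z -> idx z = n.
Proof.
move=> hn; apply: (@hit_uniq _ _ z) => //.
by apply: (@xgetPex _ 0%N [set n | hit n z]); exists n.
Qed.

Definition term w n z : R := scale n ^+ 2 * bump (w n) ((scale n)^-1 * z).
Definition dterm w n z : R := scale n * dbump (w n) ((scale n)^-1 * z).

Lemma term_out w n z : ~~ hit n z -> term w n z = 0 /\ dterm w n z = 0.
Proof.
by move=> /bump_out h; rewrite /term /dterm; have [-> ->] := h (w n); rewrite !mulr0.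
Qed.

(* At most one summand of [\sum_n term w n z] is nonzero, the one of index [idx z];
   likewise for [dterm]. *)
Definition bumps w z : R := term w (idx z) z.
Definition dbumps w z : R := dterm w (idx z) z.

Lemma term_idx w n z : n != idx z -> term w n z = 0 /\ dterm w n z = 0.
Proof.
by move=> nz; apply: term_out; apply: contra nz => /idxE ->.
Qed.

Lemma bumps_hit w n z : hit n z ->
  bumps w z = term w n z /\ dbumps w z = dterm w n z.
Proof. by rewrite /bumps /dbumps => /idxE ->. Qed.

Lemma bumps_out w z : (forall n, ~~ hit n z) -> bumps w z = 0 /\ dbumps w z = 0.
Proof. by move=> h; exact: term_out. Qed.

Definition admissible w := forall n, 0 <= w n <= 1.

(** The factor [scale n ^+ 2] compensates the rescaling of the argument, so the constant is the same
    at all levels. *)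
Lemma taylor1_term w n : admissible w -> taylor1 17 (term w n) (dterm w n).
Proof.
move=> aw; have := taylor1Z (scale n ^+ 2)
  (taylor1_affine ((scale n)^-1) 0 (taylor1_bump (aw n))).
rewrite ger0_norm ?sqr_ge0// mulrCA -exprMn divff ?scale_neq0// expr1n mulr1.
congr taylor1; apply/funext => z; rewrite addr0// /dterm mulrA expr2.
by rewrite mulfK ?scale_neq0.
Qed.

(** Only the levels of [x] and [y] matter. If they differ, each term vanishes at the other point,
    and the two remainders add up to 17 + 17. *)
Lemma taylor1_bumps w : admissible w -> taylor1 34 (bumps w) (dbumps w).
Proof.
move=> aw x y; rewrite /bumps /dbumps.
have d0 := sqr_ge0 (y - x).
have [e|ne] := eqVneq (idx x) (idx y).
  by rewrite e; apply: le_trans (taylor1_term _ aw x y) _; lra.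
have [x0 dx0] : term w (idx y) x = 0 /\ dterm w (idx y) x = 0.
  by apply: term_idx; rewrite eq_sym.
have [y0 _] := term_idx w ne.
have -> : term w (idx y) y - term w (idx x) x - dterm w (idx x) x * (y - x) =
  (term w (idx y) y - term w (idx y) x - dterm w (idx y) x * (y - x)) +
  (term w (idx x) y - term w (idx x) x - dterm w (idx x) x * (y - x)).
  by rewrite x0 dx0 y0; ring.
apply: le_trans (ler_normD _ _) _.
have := taylor1_term (idx x) aw x y; have := taylor1_term (idx y) aw x y; lra.
Qed.

Definition tail w : nat -> R := fun n => w n.+1.

Lemma hitS n z : hit n.+1 (- s * z) = hit n z.
Proof.
by rewrite /hit scaleS invfM mulrACA mulVf ?mul1r// oppr_eq0 gt_eqF// ratio_gt0.
Qed.

Lemma termS w n z : term w n.+1 (- s * z) = s ^+ 2 * term (tail w) n z /\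
  dterm w n.+1 (- s * z) = - s * dterm (tail w) n z.
Proof.
have e : (scale n.+1)^-1 * (- s * z) = (scale n)^-1 * z.
  by rewrite scaleS invfM mulrACA mulVf ?mul1r// oppr_eq0 gt_eqF// ratio_gt0.
by rewrite /term /dterm e scaleS exprMn sqrrN !mulrA.
Qed.

Lemma bumps_scale w z : - s <= z <= 1 ->
  bumps w (- s * z) = s ^+ 2 * bumps (tail w) z /\
  dbumps w (- s * z) = - s * dbumps (tail w) z.
Proof.
move=> z1; have /andP[sl su] := ratio_bounds; have s2 := ratio_sq.
(* Here [- s * z <= s^2 < 1 / 5], to the left of the support at level 0. *)
have h0 : ~~ hit 0 (- s * z).
  rewrite /hit /scale expr0 invr1 mul1r negb_and -!leNgt; apply/orP; left.
  by move/andP: z1 => [z0 z1]; nra.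
have [[n hn]|nh] := pselect (exists n, hit n z).
  have hn1 : hit n.+1 (- s * z) by rewrite hitS.
  have [-> ->] := bumps_hit w hn1; have [-> ->] := bumps_hit (tail w) hn.
  exact: termS.
have nh1 n : ~~ hit n z by apply/negP => hn; apply: nh; exists n.
have [-> ->] := bumps_out (tail w) nh1.
have [-> ->] : bumps w (- s * z) = 0 /\ dbumps w (- s * z) = 0.
  by apply: bumps_out => -[|n] //; rewrite hitS.
by rewrite !mulr0.
Qed.

Definition profile w z : R := z ^+ 2 + bumps w z.
Definition dprofile w z : R := 2 * z + dbumps w z.

Lemma taylor1_profile w : admissible w -> taylor1 35 (profile w) (dprofile w).
Proof.
move=> aw; apply: taylor1W (taylor1D (@taylor1_sq R) (taylor1_bumps aw)); lra.
Qed.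

Lemma profile_scale w z : - s <= z <= 1 ->
  profile w (- s * z) = s ^+ 2 * profile (tail w) z /\
  dprofile w (- s * z) = - s * dprofile (tail w) z.
Proof.
move=> /(bumps_scale w)[e de]; rewrite /profile /dprofile e de; split; ring.
Qed.

(** Reduces questions about the profile to [v^2 + bump t v] at a single level. *)
Lemma profile_decomp w z : exists n v, [/\ z = scale n * v, n = idx z,
  profile w z = scale n ^+ 2 * (v ^+ 2 + bump (w n) v) &
  dprofile w z = scale n * (2 * v + dbump (w n) v)].
Proof.
exists (idx z), ((scale (idx z))^-1 * z).
have e : z = scale (idx z) * ((scale (idx z))^-1 * z).
  by rewrite mulrA divff ?mul1r// scale_neq0.
split => //; rewrite /profile /dprofile /bumps /dbumps /term /dterm [RHS]mulrDr.
  by rewrite -exprMn -e.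
by rewrite [_ * (2 * _)]mulrCA -e.
Qed.

Lemma dprofile_neq0 w z : admissible w -> z != 0 -> dprofile w z != 0.
Proof.
move=> aw z0; have [n [v [e _ _ ->]]] := profile_decomp w z.
rewrite mulf_neq0 ?scale_neq0// bump_slope//.
by apply: contra z0 => /eqP v0; rewrite e v0 mulr0.
Qed.

Lemma dprofile0 w : dprofile w 0 = 0.
Proof.
have [_ h] : bumps w 0 = 0 /\ dbumps w 0 = 0; last by rewrite /dprofile h; ring.
by apply: bumps_out => n; rewrite /hit mulr0 negb_and -!leNgt; apply/orP; left; lra.
Qed.

Lemma profile0 w : profile w 0 = 0.
Proof.
have [h _] : bumps w 0 = 0 /\ dbumps w 0 = 0; last by rewrite /profile h; ring.
by apply: bumps_out => n; rewrite /hit mulr0 negb_and -!leNgt; apply/orP; left; lra.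
Qed.

Lemma profile_last w z : 4 / 5 <= z <= 1 -> profile w z = 2 * z - 1.
Proof.
(* The supports are open at 1, so this point is hit at no level and is treated apart. *)
move=> /andP[z0 z1]; have [->|nz1] := eqVneq z 1.
  rewrite /profile; have [-> _] : bumps w 1 = 0 /\ dbumps w 1 = 0; last by ring.
  apply: bumps_out => -[|n]; rewrite /hit negb_and -!leNgt.
    by rewrite /scale expr0 invr1 mul1r lexx orbT.
  have [//|h|h] := @scale_escape n 1; first by lra.
    by apply/orP; left; lra.
  by rewrite (ltW h) orbT.
have h : hit 0 z.
  have z1' : z < 1 by rewrite lt_neqAle nz1.
  by rewrite /hit /scale expr0 invr1; apply/andP; split; lra.
rewrite /profile; have [-> _] := bumps_hit w h.
rewrite /term /scale expr0 invr1 mul1r bump_last; first by ring.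
by rewrite z0 z1.
Qed.

Lemma profile1 w : profile w 1 = 1.
Proof. by rewrite profile_last; [ring | apply/andP; split; lra]. Qed.

Lemma profile_two_fifths w : profile w (2 / 5) = 4 / 25 + (2 - 5 * w 0%N) / 50.
Proof.
have h : hit 0 (2 / 5).
  by rewrite /hit /scale expr0 invr1 mul1r; apply/andP; split; lra.
rewrite /profile; have [-> _] := bumps_hit w h.
by rewrite /term /scale expr0 invr1 mul1r bump_two_fifths; field.
Qed.

Lemma scale_sq_le1 n : 0 <= scale n ^+ 2 <= 1.
Proof.
rewrite sqr_ge0/= -real_normK ?num_real// scale_norm -exprM exprn_ile1 ?ltW ?ratio_gt0//.
by have /andP[] := ratio_bounds; lra.
Qed.

Lemma profile_range w z : admissible w -> - s <= z <= 1 -> 0 <= profile w z <= 1.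
Proof.
move=> aw /andP[z0 z1].
have [h|h] := boolP (hit (idx z) z); last first.
  have [b0 _] := term_out w h; rewrite /profile /bumps b0 addr0 sqr_ge0/=.
  by have /andP[] := ratio_bounds; nra.
have [n [v [e en -> _]]] := profile_decomp w z.
have /andP[v0 v1] : 1 / 5 < v < 1.
  have ev : (scale n)^-1 * z = v by rewrite e mulrA mulVf ?scale_neq0// mul1r.
  by move: h; rewrite -en /hit ev.
have /andP[p0 p1] : 0 <= v ^+ 2 + bump (w n) v <= 1 by rewrite bump_range// !ltW.
have /andP[q0 q1] := scale_sq_le1 n.
by rewrite mulr_ge0//= mulr_ile1.
Qed.

(** Level [k] contributes at most [s^k * |w k - w' k|]: the first [n] symbols are close, and later
    levels are damped by [s^n]. *)
Lemma profile_sub w w' z n (e : R) : (forall i, `|w i - w' i| <= 1) ->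
  (forall i, (i < n)%N -> `|w i - w' i| <= e) -> s ^+ n <= e ->
  `|profile w z - profile w' z| <= e /\ `|dprofile w z - dprofile w' z| <= e.
Proof.
move=> d1 de se; have /andP[s0 s1] : 0 <= s <= 1.
  by have /andP[] := ratio_bounds => ? ?; apply/andP; split; lra.
have key k : s ^+ k * `|w k - w' k| <= e.
  have k01 : 0 <= s ^+ k <= 1 by rewrite exprn_ge0//= exprn_ile1.
  move/andP: k01 => [k0 k1]; have [kn|nk] := ltnP k n.
    by apply: le_trans (de _ kn); rewrite ler_piMl.
  apply: le_trans se; apply: (@le_trans _ _ (s ^+ k)); first by rewrite ler_piMr.
  by rewrite ler_wiXn2l.
have -> : profile w z - profile w' z = bumps w z - bumps w' z by rewrite /profile; ring.
have -> : dprofile w z - dprofile w' z = dbumps w z - dbumps w' z by rewrite /dprofile; ring.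
have sq k : `|scale k ^+ 2| = (s ^+ k) ^+ 2 by rewrite normrX scale_norm.
rewrite /bumps /dbumps /term /dterm -!mulrBr (normrM (scale _ ^+ 2)) sq.
rewrite (normrM (scale _)) scale_norm.
have := key (idx z); move: (idx z) => k kk.
have [h1 h2] := bump_sub (w k) (w' k) ((scale k)^-1 * z).
have k0 : 0 <= s ^+ k by rewrite exprn_ge0.
have k1 : s ^+ k <= 1 by rewrite exprn_ile1.
split; apply: le_trans kk; last by rewrite ler_wpM2l.
apply: ler_pM => //; first by rewrite sqr_ge0.
by rewrite expr2 ler_piMl.
Qed.

End Tower.

(** * The unimodal maps, their critical orbit and their renormalization *)

Section Maps.
Variable R : realType.
Implicit Types (w : nat -> R) (x y : R).
Local Notation s := (@ratio R).

Definition zoom x : R := (1 + s) * x - s.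

Definition tower_map w : imap R :=
  fun x => if x \in `[0, 1] then 1 - profile w (zoom x) else 0.

Definition dtower_map w x : R := - (1 + s) * dprofile w (zoom x).

Definition tip : R := s / (1 + s).

Lemma tower_mapE w x : 0 <= x <= 1 -> tower_map w x = 1 - profile w (zoom x).
Proof. by rewrite /tower_map itv01P => ->. Qed.

Lemma zoom_range x : 0 <= x <= 1 -> - s <= zoom x <= 1.
Proof.
by have := ratio_gt0 R; rewrite /zoom => s0 /andP[x0 x1]; apply/andP; split; nra.
Qed.

Lemma taylor1_tower_map w : admissible w ->
  taylor1 (35 * (1 + s) ^+ 2) (fun x => 1 - profile w (zoom x)) (dtower_map w).
Proof.
move=> aw x y /=; have := taylor1_affine (1 + s) (- s) (taylor1_profile aw) x y.
rewrite /= /zoom /dtower_map => h.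
set b := profile w _ in h *; set a := profile w _ in h *; set d := dprofile w _ in h *.
have -> : 1 - b - (1 - a) - - (1 + s) * d * (y - x) =
   - (b - a - (1 + s) * d * (y - x)) by ring.
by rewrite normrN.
Qed.

Lemma D01_tower_map w x : admissible w -> 0 <= x <= 1 ->
  D01 (tower_map w) x = dtower_map w x.
Proof. by move=> aw; exact: (D01E (@tower_mapE w) (taylor1_tower_map aw)). Qed.

Lemma tip01 : 0 < tip < 1.
Proof.
have s0 := ratio_gt0 R; have s1 : 0 < 1 + s by lra.
by rewrite /tip divr_gt0//= ltr_pdivrMr//; lra.
Qed.

Lemma zoom_tip : zoom tip = 0.
Proof.
rewrite /zoom /tip mulrCA mulfV ?mulr1 ?subrr// gt_eqF//.
by have := ratio_gt0 R; lra.
Qed.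

Lemma critical_tower_map w x : admissible w -> critical (tower_map w) x <-> x = tip.
Proof.
move=> aw; split=> [[/andP[x0 x1]]|->]; last first.
  have /andP[t0 t1] := tip01; split; first by rewrite t0 t1.
  by rewrite D01_tower_map ?ltW// /dtower_map zoom_tip dprofile0 mulr0.
have s0 := ratio_gt0 R.
rewrite D01_tower_map ?ltW// /dtower_map => /eqP; rewrite mulf_eq0 oppr_eq0.
have s1 : 1 + s != 0 by rewrite gt_eqF//; lra.
rewrite (negPf s1) /= => dz; have zx : zoom x = 0.
  by apply/eqP; apply: contraTT dz => /(dprofile_neq0 aw).
by rewrite /tip; apply: (canRL (mulfK s1)); move: zx; rewrite /zoom; lra.
Qed.

Lemma crit_tower_map w : admissible w -> crit (tower_map w) = tip.
Proof.
move=> aw; apply/(critical_tower_map _ aw); rewrite /crit.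
by apply: xgetPex; exists tip; apply/critical_tower_map.
Qed.

Lemma tower_map_tip w : tower_map w tip = 1.
Proof.
have /andP[t0 t1] := tip01.
by rewrite tower_mapE ?ltW// zoom_tip profile0 subr0.
Qed.

Lemma tower_map_range w x : admissible w -> 0 <= x <= 1 -> 0 <= tower_map w x <= 1.
Proof.
move=> aw x01; rewrite tower_mapE//.
by have /andP[g0 g1] := profile_range aw (zoom_range x01); apply/andP; split; lra.
Qed.

(* [tower_map w] is affine on [1 - s^2, 1]. *)
Lemma tower_map_last w u : 0 <= u <= 1 ->
  tower_map w (1 - s ^+ 2 * (1 - u)) = s * (1 - u).
Proof.
move=> /andP[u0 u1]; have /andP[sl su] := ratio_bounds R; have s2 := ratio_sq R.
(* By the equation of [s], [(1 + s) * s^2 = s / 2 < 1 / 5], so the point falls where the profile is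
   [2 z - 1]. *)
have zE : zoom (1 - s ^+ 2 * (1 - u)) = 1 - s / 2 * (1 - u).
  have -> : zoom (1 - s ^+ 2 * (1 - u)) = 1 - s * (s + s ^+ 2) * (1 - u).
    by rewrite /zoom; ring.
  by rewrite s2; field.
rewrite tower_mapE; last by rewrite s2; apply/andP; split; nra.
by rewrite zE profile_last; [field | apply/andP; split; nra].
Qed.

Lemma tower_map1 w : tower_map w 1 = 0.
Proof.
have := @tower_map_last w 1; rewrite subrr !mulr0 subr0; apply.
by rewrite ler01 lexx.
Qed.

Lemma zoom_scale x : zoom (s * (1 - x)) = - s * zoom x.
Proof. by rewrite /zoom; ring. Qed.

Lemma scale_range x : 0 <= x <= 1 -> 0 <= s * (1 - x) <= 1.
Proof.
by have /andP[sl su] := ratio_bounds R; move=> /andP[x0 x1]; apply/andP; split; nra.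
Qed.

Lemma tower_map_scale w x : 0 <= x <= 1 ->
  tower_map w (s * (1 - x)) = 1 - s ^+ 2 * (1 - tower_map (tail w) x).
Proof.
move=> x01; rewrite !tower_mapE ?scale_range// zoom_scale.
by have [-> _] := profile_scale w (zoom_range x01); ring.
Qed.

Lemma dtower_map_scale w x : 0 <= x <= 1 ->
  dtower_map w (s * (1 - x)) = - s * dtower_map (tail w) x.
Proof.
move=> x01; rewrite /dtower_map zoom_scale.
by have [_ ->] := profile_scale w (zoom_range x01); ring.
Qed.

Lemma tower_map0 w : tower_map w 0 = 1 - s ^+ 2.
Proof.
have := @tower_map_scale w 1; rewrite subrr mulr0 tower_map1 subr0 mulr1; apply.
by rewrite ler01 lexx.
Qed.

(** Intermediate values on [[tip, 1]], from 1 down to 0. *)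
Lemma tower_map_surj w y : admissible w -> 0 <= y <= 1 ->
  exists2 x, 0 <= x <= 1 & tower_map w x = y.
Proof.
move=> aw /andP[y0 y1]; have s0 := ratio_gt0 R.
have /andP[t0 t1] := tip01.
have cont : {within `[tip, 1], continuous (fun x => 1 - profile w (zoom x))}.
  by apply: continuous_subspaceT; apply: taylor1_continuous (taylor1_tower_map aw).
have := @IVT R _ tip 1 y (ltW t1) cont.
have etip : 1 - profile w (zoom tip) = 1 by rewrite zoom_tip profile0 subr0.
have e1 : 1 - profile w (zoom 1) = 0 by rewrite -tower_mapE ?tower_map1// lexx ler01.
rewrite etip e1 => h.
have [|x] := h; first by rewrite min_r ?max_l// y0 y1.
rewrite in_itv /= => /andP[tx x1] fx.
have x01 : 0 <= x <= 1 by rewrite x1 andbT; lra.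
by exists x => //; rewrite tower_mapE.
Qed.

(** The critical orbit starts [tip], 1, 0, [1 - s^2], [s], so the renormalization intervals are
    [[0, s]] and [[1 - s^2, 1]]. *)
Lemma iter_crit w : admissible w ->
  [/\ iter 2 (tower_map w) (crit (tower_map w)) = 0,
      iter 3 (tower_map w) (crit (tower_map w)) = 1 - s ^+ 2 &
      iter 4 (tower_map w) (crit (tower_map w)) = s].
Proof.
move=> aw; rewrite crit_tower_map// !iterS /iter.
rewrite tower_map_tip tower_map1 tower_map0; split=> //.
have := @tower_map_last w 0; rewrite subr0 !mulr1; apply.
by rewrite ler01 lexx.
Qed.

Lemma unimodal_tower_map w : admissible w -> unimodal (tower_map w).
Proof.
move=> aw; split.
- by move=> x /negPf x01; rewrite /tower_map x01.
- by move=> x; rewrite !itv01P; exact: tower_map_range.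
- by have [] := C1Lip_taylor1 (@tower_mapE w) (taylor1_tower_map aw).
- exact: tower_map1.
- split; last by rewrite crit_tower_map// tower_map_tip.
  exists tip; split; first exact/critical_tower_map.
  by move=> c /(critical_tower_map _ aw).
Qed.

(** Self-similarity carries the value 1 at [z = 1] down to every level. *)
Lemma profile_pow w n : profile w ((- s) ^+ n) = s ^+ 2 ^+ n.
Proof.
have /andP[sl su] := ratio_bounds R.
elim: n w => [|n IH] w; first by rewrite !expr0 profile1.
rewrite exprS [in RHS]exprS.
have [|-> _] := @profile_scale _ w ((- s) ^+ n); last by rewrite IH.
elim: n {IH} => [|n /andP[h1 h2]]; first by rewrite expr0; apply/andP; split; lra.
by rewrite exprS; apply/andP; split; nra.
Qed.

Lemma quadratic_tip_tower_map w : admissible w ->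
  quadratic_tip (tower_map w) (crit (tower_map w)).
Proof.
move=> aw; rewrite crit_tower_map//; have /andP[sl su] := ratio_bounds R.
have s1 : 0 < 1 + s by lra.
have s1n : 1 + s != 0 by rewrite gt_eqF.
(* The points with [zoom (x n) = (- s)^n], at which the quotient is constantly [- (1 + s)^2]. *)
pose x n : R := ((- s) ^+ n + s) / (1 + s).
have zx n : zoom (x n) = (- s) ^+ n by rewrite /zoom /x; field.
have xt n : x n - tip = (- s) ^+ n / (1 + s) by rewrite /x /tip; field.
have sn0 n : (- s) ^+ n != 0 by rewrite expf_neq0// oppr_eq0 gt_eqF//; lra.
have x01 n : 0 <= x n <= 1.
  have /andP[h1 h2] : - s <= (- s) ^+ n <= 1.
    elim: n => [|n /andP[h1 h2]]; first by rewrite expr0; apply/andP; split; lra.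
    by rewrite exprS; apply/andP; split; nra.
  have a0 : 0 <= (- s) ^+ n + s by lra.
  by rewrite /x divr_ge0 ?(ltW s1)//= ler_pdivrMr// mul1r; lra.
exists x, ((1 + s) ^+ 2); split.
- by rewrite exprn_gt0.
- move=> n; split; first by rewrite itv01P.
  by rewrite -subr_eq0 xt mulf_neq0// invr_neq0.
- have -> : x = fun n => (- s) ^+ n / (1 + s) + tip.
    by apply/funext => n; rewrite -xt subrK.
  rewrite -[X in _ --> X]add0r -(mul0r (1 + s)^-1).
  apply: cvgD; last exact: cvg_cst.
  apply: cvgMl; apply: cvg_expr.
  by rewrite normrN gtr0_norm; lra.
- rewrite (_ : (fun n => _) = fun=> - (1 + s) ^+ 2); first exact: cvg_cst.
  apply/funext => n; rewrite tower_map_tip xt tower_mapE// zx profile_pow.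
  have -> : s ^+ 2 ^+ n = ((- s) ^+ n) ^+ 2 by rewrite [RHS]exprAC sqrrN.
  by field; rewrite sn0 s1n.
Qed.

Lemma renormalizable_tower_map w : admissible w -> renormalizable (tower_map w).
Proof.
move=> aw; have /andP[sl su] := ratio_bounds R; have s2 := ratio_sq R.
have [i2 i3 i4] := iter_crit aw.
have /andP[t0 t1] := tip01.
rewrite /renormalizable /I01 /I11 i2 i3 i4 crit_tower_map// tower_map_tip.
have ash : admissible (tail w) by move=> n; exact: aw.
(* At [s * (1 - u)] the map is [1 - s^2 * (1 - g u)] with [g] the map of [tail w], so the image of
   [[0, s]] follows from the range and surjectivity of [g]. *)
have param x : 0 <= x <= s -> exists2 u, 0 <= u <= 1 & x = s * (1 - u).
  move=> /andP[x0 x1]; exists (1 - x / s); last by field; rewrite gt_eqF//; lra.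
  have h : 0 <= x / s <= 1 by rewrite divr_ge0 ?ler_pdivrMr//=; lra.
  by case/andP: h => *; apply/andP; split; lra.
split.
- rewrite /= in_itv /= ltW//= /tip ler_pdivrMr; nra.
- apply/seteqP; split=> [_ [x + <-]|y].
    rewrite /= !in_itv /= => /param[u u01 ->]; rewrite tower_map_scale//.
    by have /andP[f0 f1] := tower_map_range ash u01; apply/andP; split; nra.
  rewrite /= in_itv /= => /andP[y0 y1].
  have [|u u01 fu] := @tower_map_surj (tail w) (1 - (1 - y) / s ^+ 2) ash.
    have h : 0 <= (1 - y) / s ^+ 2 <= 1.
      by rewrite divr_ge0 ?ler_pdivrMr ?exprn_gt0//=; lra.
    by case/andP: h => *; apply/andP; split; lra.
  exists (s * (1 - u)); last first.
    by rewrite tower_map_scale// fu; field; rewrite gt_eqF//; lra.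
  by rewrite /= in_itv /=; case/andP: u01 => *; apply/andP; split; nra.
- apply/seteqP; split=> // y []; rewrite /= !in_itv /= => /andP[_ y1] /andP[y2 _].
  by lra.
Qed.

Lemma U0_tower_map w : admissible w -> U0_1Lip (tower_map w).
Proof.
move=> aw; split; last exact: renormalizable_tower_map.
split; [exact: unimodal_tower_map | | exact: quadratic_tip_tower_map].
exact: C1Lip_taylor1 (@tower_mapE w) (taylor1_tower_map aw).
Qed.

(** The first iterate lands in [[1 - s^2, 1]] as a rescaled copy of the map of [tail w]; the second
    is affine there and only rescales the copy. *)
Lemma renorm_tower_map w : admissible w -> renorm (tower_map w) = tower_map (tail w).
Proof.
move=> aw; have [i2 i3 i4] := iter_crit aw; have s0 := ratio_gt0 R.
have ash : admissible (tail w) by move=> n; exact: aw.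
apply/funext => x; rewrite /renorm; case: ifPn => [|/negPf x01]; last first.
  by rewrite /tower_map x01.
rewrite itv01P => x01; rewrite /rescale /rescale_inv i2 i4.
have -> : s + (0 - s) * x = s * (1 - x) by ring.
rewrite tower_map_scale// tower_map_last; last exact: tower_map_range.
by field; rewrite gt_eqF.
Qed.

End Maps.

(** * Lower bounds on entropy from separated families *)

Section EntropyBound.
Variables (R : realType) (X : pseudoMetricType R).
Implicit Types (T : X -> X) (K D : set X).

(** Separation forces [f] to be injective, because a ball contains its centre. *)
Lemma max_separated_ge T K n (e : R) (I : finType) (f : I -> X) : 0 < e ->
  (forall a, K (f a)) ->
  (forall a b, a != b ->
    exists2 i, (i < n)%N & ~ ball (iter i T (f a)) e (iter i T (f b))) ->
  ((#|I|%:R)%:E <= max_separated T K n e)%E.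
Proof.
move=> e0 fK sep.
have f_inj : injective f.
  move=> a b fab; apply/eqP/negPn/negP => /sep[i _]; rewrite fab; apply.
  exact: (ball_center _ (PosNum e0)).
apply: ereal_sup_ubound; exists [fset f a | a in I]%fset.
  split=> [x|x y]; rewrite /= => /imfsetP[a _ ->]; first exact: fK.
  move=> /imfsetP[b _ ->] nab; apply: sep.
  by apply: contraNneq nab => ->.
by rewrite card_imfset//= cardE.
Qed.

Lemma entropy_at_ge T K (e : R) k : 0 < e -> (0 < k)%N ->
  (forall n, exists2 f : {ffun 'I_n -> 'I_k} -> X, forall a, K (f a) &
    forall a b, a != b ->
      exists2 i, (i < n)%N & ~ ball (iter i T (f a)) e (iter i T (f b))) ->
  ((ln k%:R)%:E <= entropy_at T K e)%E.
Proof.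
move=> e0 k0 H; apply: le_ereal_inf_tmp => _ [A A_oo <-].
(* The upper limit is an infimum of suprema over eventual sets [A]; one positive [n] in [A]
   suffices, as [ln (k^n) / n = ln k]. *)
have [n [An n0]] : exists n, A n /\ (0 < n)%N.
  have FA : \forall n \near \oo, A n /\ (0 < n)%N.
    by apply: filterI => //; exists 1%N.
  exact: filter_ex FA.
apply: ereal_sup_ge; eexists; first by exists n.
have [f fK fsep] := H n.
have := max_separated_ge e0 fK fsep.
rewrite card_ffun !card_ord lee_pdivlMr ?ltr0n// -EFinM => le_max.
have kn0 : 0 < (k ^ n)%:R :> R by rewrite ltr0n expn_gt0 k0.
apply: (@le_trans _ _ (lne ((k ^ n)%:R)%:E)).
  by rewrite lne_EFin// natrX lnXn ?ltr0n// mulr_natr.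
rewrite lee_lne// in_itv /= leey andbT; first by rewrite lee_fin ltW.
by apply: le_trans le_max; rewrite lee_fin ltW.
Qed.

Lemma entropy_ge D T K (e : R) : 0 < e ->
  compact K -> K `<=` D -> T @` K `<=` K -> {within K, continuous T} ->
  (entropy_at T K e <= entropy D T)%E.
Proof.
move=> e0 cK KD TK Tc; apply: ereal_sup_ge; exists (entropy_compact T K).
  by exists K.
by apply: ereal_sup_ubound; exists e.
Qed.

End EntropyBound.

(** * The compact invariant set and the full shift on it *)

Section Horseshoe.
Variable R : realType.
Implicit Types (w : nat -> R) (f g : imap R).
Local Notation s := (@ratio R).

Definition words : set {ptws nat -> R} := [set w | forall n, `[0, 1]%classic (w n)].

Lemma words_admissible w : words w <-> admissible w.
Proof. by split=> h n; have := h n; rewrite /= in_itv. Qed.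

Definition towers : set (imap R) := [set tower_map w | w in words].

Lemma words_compact : compact words.
Proof.
exact: (@tychonoff nat (fun=> R) (fun=> `[0, 1]%classic)
  (fun=> @segment_compact R 0 1)).
Qed.

Lemma admissible_tail w : admissible w -> admissible (tail w).
Proof. by move=> aw n; exact: aw. Qed.

Lemma admissible_sub w w' i : admissible w -> admissible w' -> `|w i - w' i| <= 1.
Proof.
move=> /(_ i)/andP[a0 a1] /(_ i)/andP[b0 b1].
by rewrite ler_norml; apply/andP; split; lra.
Qed.

(** The values contribute [d], the derivatives [(1 + s) * d <= 2 * d]. *)
Lemma tower_dist_le w w' n (d : R) : admissible w -> admissible w' ->
  (forall i, (i < n)%N -> `|w i - w' i| <= d) -> s ^+ n <= d ->
  (dist1 (tower_map w) (tower_map w') <= (3 * d)%:E)%E.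
Proof.
move=> aw aw' hd sd; have /andP[sl su] := ratio_bounds R.
have G_le x := profile_sub (zoom x) (fun i => admissible_sub i aw aw') hd sd.
have -> : 3 * d = d + 2 * d by ring.
apply: dist1_le => x x01.
  rewrite !tower_mapE//; have [h _] := G_le x.
  have -> (a b : R) : 1 - a - (1 - b) = - (a - b) by ring.
  by rewrite normrN.
have [_ h] := G_le x.
have s1 : `|1 + s| = 1 + s by rewrite ger0_norm//; lra.
rewrite !D01_tower_map// /dtower_map -mulrBr normrM normrN s1.
by apply: ler_pM => //; lra.
Qed.

Lemma forall_lt_near (T : Type) (F : set_system T) (FF : Filter F)
    (P : nat -> set T) n :
  (forall i, F (P i)) -> F [set x | forall i, (i < n)%N -> P i x].
Proof.
move=> FP; elim: n => [|n IH]; first exact: filterE.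
apply: filterS (filterI IH (FP n)) => x [h Pn] i.
by rewrite ltnS leq_eqVlt => /orP[/eqP ->|/h].
Qed.

(** A product neighbourhood controls finitely many symbols, and the others matter only up to
    [s^n]. *)
Lemma tower_continuous :
  {within words, continuous (@tower_map R : {ptws nat -> R} -> imap R)}.
Proof.
apply/subspace_continuousP => w /words_admissible aw; apply/cvg_ballP => e e0.
have /andP[sl su] := ratio_bounds R.
have d0 : 0 < e / 4 by rewrite divr_gt0.
have [n sn] : exists n, s ^+ n <= e / 4.
  have s1 : `|s| < 1 by rewrite ger0_norm; lra.
  have /cvgrPdist_le/(_ _ d0)[n _ h] := cvg_expr s1.
  exists n; have := h n (leqnn n); rewrite /= sub0r normrN.
  exact: le_trans (ler_norm _).
have near_w : nbhs (w : {ptws nat -> R})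
    [set w' | forall i, (i < n)%N -> ball (w i) (e / 4) (w' i)].
  apply: (@forall_lt_near {ptws nat -> R} (nbhs (w : {ptws nat -> R})) _
    (fun i => @proj nat (fun=> R) i @^-1` ball (w i) (e / 4))) => i.
  exact: (@proj_continuous nat (fun=> R) i w _ (nbhsx_ballx (w i : R) _ d0)).
suff near_ball : nbhs (w : {ptws nat -> R})
    [set w' | words w' -> ball (tower_map w) e (tower_map w')] by exact: near_ball.
apply: (@filterS _ (nbhs (w : {ptws nat -> R})) _ _ _ _ near_w).
move=> w' hw' /words_admissible aw'.
rewrite imap_ballE.
apply: (@le_lt_trans _ _ (3 * (e / 4))%:E); last by rewrite lte_fin; lra.
by apply: (tower_dist_le aw aw' _ sn) => i /hw' /ltW.
Qed.

Lemma towers_compact : compact towers.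
Proof. exact: continuous_compact tower_continuous words_compact. Qed.

Lemma towers_U0 : towers `<=` @U0_1Lip R.
Proof. by move=> _ [w /words_admissible aw <-]; exact: U0_tower_map. Qed.

Lemma towers_renorm : @renorm R @` towers `<=` towers.
Proof.
move=> _ [_ [w /words_admissible aw <-] <-].
by exists (tail w); [exact/words_admissible/admissible_tail | rewrite renorm_tower_map].
Qed.

(* By self-similarity [renorm] expands C^1 distances between towers by at most
   [s ^- 2 < 8]. *)
Lemma renorm_continuous : {within towers, continuous (@renorm R)}.
Proof.
apply/subspace_continuousP => _ [w /words_admissible aw <-]; apply/cvg_ballP => e e0.
have /andP[sl su] := ratio_bounds R; have s2 := ratio_sq R.
rewrite near_withinE; apply/nbhs_ballP; exists (e / 17); first by rewrite /= divr_gt0.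
move=> f /= close [w' /words_admissible aw' ew]; move: close.
rewrite -ew !imap_ballE => close.
suff : (dist1 (renorm (tower_map w)) (renorm (tower_map w')) < e%:E)%E by [].
rewrite !renorm_tower_map//.
apply: (@le_lt_trans _ _ (8 * (e / 17) + 8 * (e / 17))%:E); last first.
  by rewrite lte_fin; lra.
have tw := admissible_tail aw; have tw' := admissible_tail aw'.
(* The renormalized maps at [x] are compared through the original ones at [s * (1 - x)]. *)
apply: dist1_le => x x01; have [h dh] := dist1_lt close (scale_range x01).
  move: h; rewrite !tower_map_scale//.
  have -> (a b : R) : 1 - s ^+ 2 * (1 - a) - (1 - s ^+ 2 * (1 - b)) =
    s ^+ 2 * (a - b) by ring.
  rewrite normrM [ `|s ^+ 2|]ger0_norm ?sqr_ge0// s2.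
  have := normr_ge0 (tower_map (tail w) x - tower_map (tail w') x).
  by move: `|_ - _| => a ? ?; nra.
move: dh; rewrite !D01_tower_map ?scale_range// !dtower_map_scale//.
have sn : `|s| = s by rewrite ger0_norm//; lra.
rewrite -mulrBr normrM normrN sn.
have := normr_ge0 (dtower_map (tail w) x - dtower_map (tail w') x).
by move: `|_ - _| => a ? ?; nra.
Qed.

(** Renormalizing [i] times brings symbol [i] to the front, where [tower_close] detects it. *)
Lemma iter_renorm w i : admissible w ->
  exists w', [/\ admissible w', w' 0%N = w i &
    iter i (@renorm R) (tower_map w) = tower_map w'].
Proof.
move=> aw; exists (fun n => w (n + i)%N); split; first by move=> n; exact: aw.
  by rewrite add0n.
elim: i => [|i IH] /=.
  by congr tower_map; apply/funext => n; rewrite addn0.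
rewrite IH renorm_tower_map; last by move=> n; exact: aw.
by congr tower_map; apply/funext => n; rewrite /tail addSnnS.
Qed.

Lemma tower_close w w' (e : R) : admissible w -> admissible w' ->
  ball (tower_map w) e (tower_map w') -> `|w 0%N - w' 0%N| < 10 * e.
Proof.
move=> aw aw'; rewrite imap_ballE => close; have /andP[sl su] := ratio_bounds R.
have s1 : 0 < 1 + s by lra.
(* The point with [zoom x = 2 / 5], where the value is affine in [w 0] with slope 1/10; hence the
   factor 10. *)
pose x := (2 / 5 + s) / (1 + s).
have zx : zoom x = 2 / 5 by rewrite /zoom /x; field; rewrite gt_eqF.
have x01 : 0 <= x <= 1.
  by rewrite /x divr_ge0 ?(ltW s1)//= ?ler_pdivrMr// ?mul1r; lra.
have [h _] := dist1_lt close x01; move: h; rewrite !tower_mapE// zx !profile_two_fifths.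
by rewrite !ltr_norml => /andP[h1 h2]; apply/andP; split; lra.
Qed.

(** Multiples of [1 / k] serve as the [k] symbols; positions from [n] on are filled with 0. *)
Definition digits k n (a : {ffun 'I_n -> 'I_k}) : nat -> R :=
  fun i => oapp (fun j => (a j)%:R / k%:R) 0 (insub i).

Lemma digits_admissible k n (a : {ffun 'I_n -> 'I_k}) : admissible (digits a).
Proof.
move=> i; rewrite /digits; case: insubP => [j _ _|_] /=; last by rewrite lexx ler01.
have k0 : 0 < k%:R :> R by rewrite ltr0n (leq_ltn_trans _ (ltn_ord (a j))).
by rewrite divr_ge0//= ler_pdivrMr// mul1r ler_nat ltnW.
Qed.

Lemma towers_entropy_at k : (0 < k)%N ->
  ((ln k%:R)%:E <= entropy_at (@renorm R) towers (10 * k%:R)^-1)%E.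
Proof.
move=> k0; have kR : 0 < k%:R :> R by rewrite ltr0n.
apply: entropy_at_ge => //; first by rewrite invr_gt0 mulr_gt0.
move=> n; exists (fun a => tower_map (digits a)).
  by move=> a; exists (digits a) => //; apply/words_admissible/digits_admissible.
move=> a b nab; have [i nai] : exists i, a i != b i.
  by apply/existsP; apply: contraNT nab => /existsPn h; apply/eqP/ffunP => i;
     apply/eqP/negPn/h.
exists i => //.
have [u [au u0 ->]] := iter_renorm i (digits_admissible a).
have [v [av v0 ->]] := iter_renorm i (digits_admissible b).
(* Closeness would put the symbols less than [1 / k] apart, whereas distinct digits differ by at
   least [1 / k]. *)
move/(tower_close au av); rewrite u0 v0 /digits valK /= -mulrBl normrM.
rewrite [ `|_^-1|]gtr0_norm ?invr_gt0// invfM mulrA divff// mul1r.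
rewrite gtr_pMl ?invr_gt0//.
have : (nat_of_ord (a i) != nat_of_ord (b i)) by [].
rewrite neq_ltn => /orP[] lt; apply/negP; rewrite -leNgt.
  by rewrite distrC -natrB 1?ltnW// normr_nat ler1n subn_gt0.
by rewrite -natrB 1?ltnW// normr_nat ler1n subn_gt0.
Qed.

End Horseshoe.

Theorem theorem1p7 (R : realType) :
  entropy (@U0_1Lip R) (@renorm R) = +oo%E.
Proof.
apply: eq_infty => r.
(* This [k] exceeds [exp r]. The compact set is the same for all [k]; only the scale of separation
   shrinks. *)
pose k := (Num.truncn (expR r)).+1.
have rk : r <= ln (k%:R : R).
  by rewrite -[r]expRK ler_ln ?posrE ?expR_gt0 ?ltr0n// ltW// truncnS_gt.
apply: (@le_trans _ _ (ln (k%:R : R))%:E); first by rewrite lee_fin.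
apply: le_trans (towers_entropy_at R (ltn0Sn _)) _.
apply: entropy_ge.
- by rewrite invr_gt0 mulr_gt0// ltr0n.
- exact: towers_compact.
- exact: towers_U0.
- exact: towers_renorm.
- exact: renorm_continuous.
Qed.
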